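(* Suppose $X$ is a proper hyperbolic geodesic metric space and the barycenter map $\partial^3X\to X$ is coarsely surjective. Then the trivalent tree $T_3$ can be quasiisometrically embedded in $X$. Moreover, the quasiisometric embedding constant depends only on the hyperbolicity constant of $X$ and the coarse surjectivity constant of the barycenter map.
   Context: $T_3$ is the simplicial metric tree (edges of length $1$) in which every vertex has valence exactly $3$. Hyperbolic means Gromov hyperbolic. A map $\phi:Y\to Z$ is a $k$-qi embedding ($k\ge1$) if $\frac1k d(y,y')-k\le d(\phi(y),\phi(y'))\le k\,d(y,y')+k$ for all $y,y'\in Y$; a quasiisometric embedding is a $k$-qi embedding for some $k\ge1$. A map $\phi:Y\to Z$ is $L$-coarsely surjective if every point of $Z$ is within distance $L$ of $\phi(Y)$, and coarsely surjective if this holds for some $L\ge0$. Barycenter map. For a proper $\delta$-hyperbolic geodesic space $X$ with geodesic boundary $\partial X$, let $\partial^3X$ be the set of triples of pairwise distinct points of $\partial X$. There are constants $D_0(\delta),R_0(\delta)\ge0$ such that for each $(\xi_1,\xi_2,\xi_3)\in\partial^3X$ there is a point of $X$ (a barycenter) within $D_0(\delta)$ of every geodesic line joining $\xi_i$ and $\xi_j$, $i\ne j$, and any two such points are at distance at most $R_0(\delta)$. A barycenter map $\partial^3X\to X$ sends each triple to a chosen barycenter. *)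

(* Defs.v *)
From HB Require Import structures.
From mathcomp Require Import all_boot all_order all_algebra.
From mathcomp Require Import all_classical all_reals all_analysis.
From mathcomp Require Import zify lra.

Set Implicit Arguments.
Unset Strict Implicit.
Unset Printing Implicit Defensive.

Import Order.TTheory GRing.Theory Num.Theory.

Local Open Scope classical_set_scope.
Local Open Scope ring_scope.

(* ** Metric geometry *)

Section MetricGeometry.
Context {R : realType} (X : metricType R).

(* Paths are total functions R -> X; only their values on the relevant
   interval are constrained. *)
Definition geodesic_segment (x y : X) (g : R -> X) : Prop :=
  [/\ g 0 = x, g (mdist x y) = y &
      forall s t, 0 <= s <= mdist x y -> 0 <= t <= mdist x y ->
        mdist (g s) (g t) = `|s - t|].

Definition geodesic_space : Prop :=
  forall x y : X, exists g, geodesic_segment x y g.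

Definition proper_space : Prop :=
  forall (x : X) (r : R), compact [set y | mdist x y <= r].

(* Rips condition: geodesic triangles are delta-slim. Only the side from x to y
   is mentioned, the other two sides being covered by permuting x, y, z. *)
Definition delta_hyperbolic (delta : R) : Prop :=
  forall (x y z : X) (a b c : R -> X),
    geodesic_segment x y a -> geodesic_segment y z b ->
    geodesic_segment x z c ->
    forall s, 0 <= s <= mdist x y ->
      (exists2 t, 0 <= t <= mdist y z & mdist (a s) (b t) <= delta) \/
      (exists2 t, 0 <= t <= mdist x z & mdist (a s) (c t) <= delta).

Definition geodesic_ray (g : R -> X) : Prop :=
  forall s t, 0 <= s -> 0 <= t -> mdist (g s) (g t) = `|s - t|.

Definition geodesic_line (g : R -> X) : Prop :=
  forall s t, mdist (g s) (g t) = `|s - t|.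

Definition asymptotic (g h : R -> X) : Prop :=
  exists C : R, forall t, 0 <= t -> mdist (g t) (h t) <= C.

Definition asymptotic_class (g : R -> X) : set (R -> X) :=
  [set h | geodesic_ray h /\ asymptotic g h].

(* The geodesic boundary: the set of asymptotic classes of geodesic rays. *)
Definition boundary : Type :=
  {xi : set (R -> X) | exists2 g, geodesic_ray g & xi = asymptotic_class g}.

Definition converges_to (g : R -> X) (xi : boundary) : Prop := sval xi g.

Definition joins (g : R -> X) (xi eta : boundary) : Prop :=
  [/\ geodesic_line g, converges_to (fun t => g (- t)) xi &
      converges_to g eta].

Definition boundary3 : Type := {xi : 'I_3 -> boundary | injective xi}.

Definition is_barycenter (D : R) (xi : boundary3) (x : X) : Prop :=
  forall (i j : 'I_3) (g : R -> X), i != j ->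
    joins g (sval xi i) (sval xi j) -> exists t, mdist x (g t) <= D.

Definition is_barycenter_map (D : R) (b : boundary3 -> X) : Prop :=
  forall xi, is_barycenter D xi (b xi).

End MetricGeometry.

Arguments geodesic_space {R} X.
Arguments proper_space {R} X.
Arguments delta_hyperbolic {R} X delta.
Arguments boundary {R} X.
Arguments boundary3 {R} X.

Section CoarseMaps.
Context {R : realType}.

Definition coarsely_surjective_with (L : R) (Y : Type) (Z : metricType R)
    (phi : Y -> Z) : Prop :=
  forall z, exists y, mdist z (phi y) <= L.

Definition coarsely_surjective (Y : Type) (Z : metricType R)
    (phi : Y -> Z) : Prop :=
  exists2 L, 0 <= L & coarsely_surjective_with L phi.

Definition qi_embedding_with (k : R) (Y Z : metricType R)
    (phi : Y -> Z) : Prop :=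
  1 <= k /\
  forall y y', k^-1 * mdist y y' - k <= mdist (phi y) (phi y') <=
               k * mdist y y' + k.

Definition qi_embedding (Y Z : metricType R) (phi : Y -> Z) : Prop :=
  exists k, qi_embedding_with k phi.

End CoarseMaps.

(* ** The trivalent tree T_3 *)

(* A vertex is a word over three letters without two equal consecutive letters:
   the empty word is a base vertex, and [rcons w a] is a neighbour of [w].
   Equivalently, this is the Cayley tree of Z/2 * Z/2 * Z/2. *)
Definition reduced (w : seq 'I_3) : bool := sorted (fun a b => a != b) w.

(* [(w, s)] is the point at distance [s] from the vertex [w] on the edge joining
   [w] to its parent; excluding [s = 1] makes this representation unique. *)
Definition T3_pred (R : realType) (p : seq 'I_3 * R) : bool :=
  [&& reduced p.1, 0 <= p.2 < 1 & (p.1 == [::]) ==> (p.2 == 0)].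

Definition T3 (R : realType) : Type := {p : seq 'I_3 * R | T3_pred p}.

HB.instance Definition _ (R : realType) := Choice.on (T3 R).

(* Length of the longest common prefix. *)
Fixpoint lcp (u v : seq 'I_3) : nat :=
  match u, v with
  | a :: u', b :: v' => if a == b then (lcp u' v').+1 else 0%N
  | _, _ => 0%N
  end.

Section T3Metric.
Context {R : realType}.
Implicit Types p q r : T3 R.

(* Distance to the base vertex. *)
Definition T3_height p : R := (size (sval p).1)%:R - (sval p).2.

(* Height of the point where the geodesics from the base vertex to p and to q
   branch off. *)
Definition T3_branch p q : R :=
  Num.min (lcp (sval p).1 (sval q).1)%:R
          (Num.min (T3_height p) (T3_height q)).

Definition T3_dist p q : R :=
  (T3_height p - T3_branch p q) + (T3_height q - T3_branch p q).

Lemma lcpC u v : lcp u v = lcp v u.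
Proof.
by elim: u v => [|a u IH] [|b v] //=; rewrite eq_sym IH.
Qed.

Lemma lcpxx u : lcp u u = size u.
Proof. by elim: u => //= a u ->; rewrite eqxx. Qed.

Lemma lcp_trans v u w : (minn (lcp u v) (lcp v w) <= lcp u w)%N.
Proof.
elim: u v w => [|a u IH] [|b v] [|c w] //=; rewrite ?minn0 ?min0n //.
case: (eqVneq a b) => [<-|_]; last by rewrite min0n.
by case: eqP => _; rewrite ?minn0 // minnSS ltnS.
Qed.

Lemma lcp_eq u v : (size u <= lcp u v)%N -> (size v <= lcp u v)%N -> u = v.
Proof.
elim: u v => [|a u IH] [|b v] //=.
by case: eqP => // -> /IH{}IH /IH ->.
Qed.

Lemma T3_sP p : 0 <= (sval p).2 < 1.
Proof. by case: p => -[w s] /= /and3P[]. Qed.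

Lemma T3_height_ge0 p : 0 <= T3_height p.
Proof.
rewrite /T3_height; case: p => -[[|a w] s] /= /and3P[_ /= /andP[s0 s1]].
  by move=> /eqP ->; rewrite subr0.
by move=> _; rewrite subr_ge0 (le_trans (ltW s1))// ler1n.
Qed.

Lemma T3_distxx p : T3_dist p p = 0.
Proof.
rewrite /T3_dist /T3_branch lcpxx minxx min_r ?subrr ?addr0//.
by rewrite /T3_height lerBlDr lerDl; case/andP: (T3_sP p).
Qed.

Lemma T3_dist_sym p q : T3_dist p q = T3_dist q p.
Proof.
by rewrite /T3_dist /T3_branch lcpC [Num.min (T3_height p) _]minC addrC.
Qed.

Lemma T3_branch_le p q :
  [/\ T3_branch p q <= (lcp (sval p).1 (sval q).1)%:R,
      T3_branch p q <= T3_height p & T3_branch p q <= T3_height q].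
Proof. by rewrite /T3_branch !ge_min !lexx !orbT. Qed.

Lemma T3_dist_positivity p q : T3_dist p q = 0 -> p = q.
Proof.
have [bl bp bq] := T3_branch_le p q; rewrite /T3_dist => d0.
have hp : T3_height p = T3_branch p q by lra.
have hq : T3_height q = T3_branch p q by lra.
have near n (s : R) l : n%:R - s <= l%:R -> 0 <= s < 1 -> (n <= l)%N.
  move=> nl /andP[_ s1]; rewrite -ltnS -(ltr_nat R) -natr1; lra.
have sp := T3_sP p; have sq := T3_sP q.
have wE : (sval p).1 = (sval q).1.
  apply: lcp_eq.
    by apply: near sp; rewrite -[leLHS]/(T3_height p) hp.
  by apply: near sq; rewrite -[leLHS]/(T3_height q) hq.
have : T3_height p = T3_height q by rewrite hp hq.
rewrite /T3_height wE => /addrI/oppr_inj sE.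
apply: val_inj => /=; rewrite [LHS]surjective_pairing [RHS]surjective_pairing.
by rewrite wE sE.
Qed.

Lemma T3_dist_triangle q p r : T3_dist p r <= T3_dist p q + T3_dist q r.
Proof.
suff : Num.min (T3_branch p q) (T3_branch q r) <= T3_branch p r.
  have [_ _ b1] := T3_branch_le p q; have [_ b2 _] := T3_branch_le q r.
  rewrite /T3_dist ge_min => /orP[] ?; lra.
have [l1 p1 q1] := T3_branch_le p q; have [l2 q2 r2] := T3_branch_le q r.
have minl (x y z : R) : x <= z -> Num.min x y <= z.
  by move=> xz; rewrite ge_min xz.
have minr (x y z : R) : y <= z -> Num.min x y <= z.
  by move=> yz; rewrite ge_min yz orbT.
have bmin (x : R) : x <= (lcp (sval p).1 (sval r).1)%:R -> x <= T3_height p ->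
    x <= T3_height r -> x <= T3_branch p r.
  by move=> ? ? ?; rewrite /T3_branch le_min; apply/andP; split=> //;
    rewrite le_min; apply/andP.
apply: bmin; [|exact: minl|exact: minr].
have := lcp_trans (sval q).1 (sval p).1 (sval r).1.
rewrite geq_min => /orP[] l; [apply: minl|apply: minr].
  by apply: (le_trans l1); rewrite ler_nat.
by apply: (le_trans l2); rewrite ler_nat.
Qed.

HB.instance Definition _ := isMetric.Build R (T3 R)
  T3_distxx T3_dist_positivity T3_dist_sym T3_dist_triangle.

(* Sanity check: every vertex has exactly three adjacent vertices. *)
Definition is_vertex p : Prop := (sval p).2 = 0.

Lemma T3_valence v : is_vertex v ->
  exists2 f : 'I_3 -> T3 R, injective f &
    forall q, (is_vertex q /\ mdist v q = 1) <-> (exists i, q = f i).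
Proof.
have lcp_le u w : (lcp u w <= size u)%N.
  by elim: u w => [|a u IH] [|b w] //=; case: eqP => // _; rewrite ltnS.
have lcp_rcons u a : lcp u (rcons u a) = size u.
  by elim: u => //= b u ->; rewrite eqxx.
have lcp1 u w : (size u + size w = (lcp u w).*2.+1)%N ->
    (exists a, w = rcons u a) \/ (exists a, u = rcons w a).
  elim: u w => [|a u IH] [|b w] //=.
  - by case: w => [|c w] /=; [left; exists b|lia].
  - by case: u {IH} => [|c u] /=; [right; exists a|lia].
  - case: eqP => [<-|_]; last by rewrite addnS.
    rewrite addSn addnS doubleS => -[] /IH [[c ->]|[c ->]].
      by left; exists c.
    by right; exists c.
have red_rcons u a b : reduced (rcons (rcons u a) b) =
    reduced (rcons u a) && (a != b).
  by case: u => [|c u] //=; rewrite /reduced /= ?rcons_path ?last_rcons ?andbT.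
have red_pre u a : reduced (rcons u a) -> reduced u.
  by case: u => //= c u; rewrite /reduced /= rcons_path => /andP[].
have mk u : reduced u -> T3_pred (u, 0 : R).
  by move=> ru; rewrite /T3_pred /= ru lexx ltr01 eqxx implybT.
have distE (p q : T3 R) : is_vertex p -> is_vertex q ->
    (mdist p q = 1) <-> (size (sval p).1 + size (sval q).1 =
      (lcp (sval p).1 (sval q).1).*2.+1)%N.
  rewrite /is_vertex => p0 q0; rewrite /mdist /= /T3_dist /T3_branch.
  rewrite /T3_height p0 q0 !subr0 min_l; last first.
    by rewrite le_min !ler_nat lcp_le lcpC lcp_le.
  set m := size _; set n := size _; set l := lcp _ _.
  split=> [e|e].
    apply/eqP; rewrite -(eqr_nat R) natrD -addn1 -addnn !natrD.
    by apply/eqP; lra.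
  by have := congr1 (fun n => n%:R : R) e; rewrite -addnn -addn1 !natrD; lra.
have valE (p : T3 R) u : is_vertex p -> (sval p).1 = u ->
    forall ru : T3_pred (u, 0 : R), p = exist _ (u, 0) ru.
  move=> p0 pu ru; apply: val_inj => /=.
  by rewrite [LHS]surjective_pairing pu p0.
case: v => -[w s] wP; rewrite /is_vertex /= => s0; subst s.
have rw : reduced w by case/and3P: (wP).
suff [g [gI rg gP]] : exists g : 'I_3 -> seq 'I_3, [/\ injective g,
    forall i, reduced (g i) & forall x, reduced x ->
      (size w + size x = (lcp w x).*2.+1)%N <-> exists i, x = g i].
  exists (fun i => exist _ (g i, 0) (mk _ (rg i)) : T3 R).
    by move=> i j /(congr1 sval)[] /gI.
  move=> q; split=> [[q0 /distE -/(_ erefl q0) /= /gP]|[i ->]].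
    case: (q) q0 => -[x s] /= xP q0; have /and3P[rx _ _] := xP.
    by move=> /(_ rx)[i xi]; exists i; apply: valE.
  by split=> //; apply/distE => //=; apply/gP => //; exists i.
case: (lastP w) rw => [_|u a rw].
  exists (fun i => [:: i]); split=> // [i j []//|x _].
  split=> [/lcp1[[a ->]|[a]]|[i ->]//]; first by exists a.
  by case: x.
exists (fun i => if i == a then u else rcons (rcons u a) i); split.
- move=> i j; case: eqP => [->|_]; case: eqP => [->|_] //.
  + by move/(congr1 size); rewrite !size_rcons; lia.
  + by move/(congr1 size); rewrite !size_rcons; lia.
  + by move/rcons_inj => [].
- move=> i; case: eqVneq => [_|ia]; first exact: red_pre rw.
  by rewrite red_rcons rw eq_sym.
- move=> x rx; split=> [/lcp1[[c xE]|[c /rcons_inj[<- _]]]|[i ->]].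
  + exists c; case: eqVneq => [ca|//].
    by move: rx; rewrite xE red_rcons ca eqxx andbF.
  + by exists a; rewrite eqxx.
  + case: eqP => _.
      by rewrite lcpC lcp_rcons size_rcons; lia.
    by rewrite lcp_rcons !size_rcons; lia.
Qed.

End T3Metric.

(* Main.v *)
Require Import Defs.
From HB Require Import structures.
From mathcomp Require Import all_boot all_order all_algebra.
From mathcomp Require Import perm.
From mathcomp Require Import all_classical all_reals all_analysis.
From mathcomp Require Import zify lra.

(** Coarse surjectivity of the barycenter map says that every point x of X is
    a coarse branching point: x lies near a barycenter of some triple of
    boundary points, so three geodesic rays leave the neighbourhood of x in
    pairwise diverging directions. Cutting them at distance N from x gives three
    points at distance N from x whose mutual Gromov products at x are
    bounded independently of N ([tripod_at]).

    Given a further point y, hyperbolicity allows at most one of these three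
    points to lie in the direction of y, so the other two continue any path
    from y to x without coarse backtracking ([tripod_forks]). Starting
    from an arbitrary point and iterating this choice along reduced words gives
    a map from the vertices of the trivalent tree to X: an edge has length N in
    X and the Gromov product at each turn is at most a constant C. As soon
    as N is large compared to C and to the hyperbolicity constant, such
    broken geodesics are quasi-geodesics: by induction along the word, the
    starting point and the end point keep a bounded Gromov product at each
    vertex ([walk_no_return]). This gives the lower bound on distances; the
    upper bound is the triangle inequality.

    The barycenter condition constrains x through lines joining two boundary
    points, so such a line must first be produced ([limit_line]). If two rays g
    and h are not asymptotic, the geodesics from g n to h n pass within bounded
    distance of a fixed point; parametrized from there, they stay in compact
    balls and converge pointwise along an ultrafilter to a line. The limit line
    passes near the barycenter, hence so do the geodesics from g n to h n for
    almost all n, which bounds the Gromov product of g n and h n. One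
    ultrafilter serves all pairs of rays, so a single n can be chosen
    for the three of them.

    Hyperbolicity is used in the four-point form, which follows from
    slim triangles ([slim_four_point]). *)

Set Implicit Arguments.
Unset Strict Implicit.
Unset Printing Implicit Defensive.

Import Order.TTheory GRing.Theory Num.Theory.

Local Open Scope ring_scope.

(** Distances and plain real numbers inhabit convertible but differently
    displayed carriers, and [lra] takes from the context only what is displayed
    as the goal is; once in the goal, all the inequalities are read alike. *)
Ltac lra_hyps := repeat match goal with
  | H : is_true (Order.le _ _) |- _ => revert H
  | H : is_true (Order.lt _ _) |- _ => revert H
  | H : is_true (Order.le _ _ && Order.le _ _) |- _ => revert H
  end; lra.

(** * Gromov products *)

Section GromovProduct.
Context {R : realType} {X : metricType R}.
Implicit Types (e : R) (o p q w x y z : X).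

Definition gromov_product w x y : R :=
  (mdist w x + mdist w y - mdist x y) / 2.

Local Notation gp := gromov_product.

Definition between p x y : Prop := mdist x p + mdist p y = mdist x y.

(** Gromov's inequality, that the product at w of x and z is at least the
    minimum of the products with y, up to e, unfolded into a disjunction of
    linear inequalities. *)
Definition four_point e : Prop := forall w x y z,
  gp w x y <= gp w x z + e \/ gp w y z <= gp w x z + e.

Lemma gromov_productC w x y : gp w x y = gp w y x.
Proof. by rewrite /gp (metric_sym x y); lra. Qed.

(** The two products are the lengths cut out on the side from x to y by the
    point where the comparison tripod of x, y, z branches. *)
Lemma gromov_product_swap x y z : gp x y z + gp y x z = mdist x y.
Proof. by rewrite /gp (metric_sym y x); lra. Qed.

Lemma gromov_productx w x : gp w w x = 0.
Proof. by rewrite /gp mdistxx; lra. Qed.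

Lemma gromov_product_base v w x y : gp w x y <= gp v x y + mdist w v.
Proof.
have := metric_triangle w v x; have := metric_triangle w v y.
by rewrite /gp; lra.
Qed.

Lemma gromov_product_le_dist w p x y : between p x y -> gp w x y <= mdist w p.
Proof.
rewrite /between /gp => pxy; rewrite (metric_sym x p) in pxy.
have := metric_triangle w p x; have := metric_triangle w p y.
by lra.
Qed.

Lemma gromov_product_between w p x y : between p w x -> gp w p y <= gp w x y.
Proof. by rewrite /between /gp; have := metric_triangle x p y;
  rewrite (metric_sym x p); lra. Qed.

Lemma segment_between x y g s : geodesic_segment x y g ->
  0 <= s <= mdist x y -> between (g s) x y.
Proof.
case=> g0 g1 gd sI; rewrite /between -[in mdist x _]g0 -[in mdist _ y]g1.
have := mdist_ge0 x y.
rewrite !gd// ?lexx ?mdist_ge0//=; case/andP: sI => s0 s1 ?.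
rewrite sub0r normrN ger0_norm//; rewrite ler0_norm; lra.
Qed.

Lemma segment_start x y g s : geodesic_segment x y g ->
  0 <= s <= mdist x y -> mdist x (g s) = s.
Proof.
case=> g0 g1 gd /[dup] sI /andP[s0 s1]; rewrite -[in mdist x _]g0.
by rewrite gd ?lexx ?mdist_ge0// sub0r normrN ger0_norm.
Qed.

End GromovProduct.

(** * From slim triangles to the four-point inequality *)

Section SlimTriangles.
Context {R : realType} {X : metricType R} (delta : R).
Hypotheses (d0 : 0 <= delta) (gX : geodesic_space X)
  (hX : delta_hyperbolic X delta).
Local Notation gp := gromov_product.

(** The points of the side from x to y that are close to the side from x to w
    and those close to the side from y to w cover the segment; around the
    supremum of the former there are two points, at most 1 apart, one of each
    kind. They are near the centre of the triangle, whose distance to w is the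
    Gromov product. The 1 spares an argument on closed sets. *)
Lemma slim_dist_segment (w x y : X) a : geodesic_segment x y a ->
  exists2 s, 0 <= s <= mdist x y & mdist w (a s) <= gp w x y + 2 * (delta + 1).
Proof.
move=> axy; have [b ayw] := gX y w; have [c cxw] := gX x w.
have [a0 a1 ad] := axy; have [b0 b1 bd] := ayw; have [c0 c1 cd] := cxw.
pose nearc s := exists2 t, 0 <= t <= mdist x w & mdist (a s) (c t) <= delta.
pose nearb s := exists2 t, 0 <= t <= mdist y w & mdist (a s) (b t) <= delta.
have l0 := mdist_ge0 x y.
have [s [s' [sI s'I [t tI st] [t' t'I s't'] ss']]] : exists s s' : R,
    [/\ 0 <= s <= mdist x y, 0 <= s' <= mdist x y, nearc s, nearb s' &
        `|s - s'| <= 1 /\ s' <= s + 1].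
  pose A := [set s | 0 <= s <= mdist x y /\ nearc s]%classic.
  have A0 : A 0.
    rewrite /A /=; split; first by rewrite lexx l0.
    by exists 0; rewrite ?lexx ?mdist_ge0// a0 c0 mdistxx.
  have ubA : has_sup A.
    by split; [exists 0|exists (mdist x y) => s [/andP[]]].
  have [s [/[dup] sI /andP[s0 sl] ns] sA] := sup_adherent ltr01 ubA.
  have [sl1|sl1] := leP (s + 1) (mdist x y).
    have s1I : 0 <= s + 1 <= mdist x y by apply/andP; split; lra.
    exists s, (s + 1); split => //; last by rewrite opprD addNKr normrN normr1.
    have [//|ns1] := hX axy ayw cxw s1I.
    have : s + 1 <= sup A by apply: ub_le_sup => //; case: ubA.
    by lra.
  exists s, (mdist x y); split => //; first by rewrite lexx l0.
    by exists 0; rewrite ?lexx ?mdist_ge0// a1 b0 mdistxx.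
  by rewrite ler0_norm; lra.
exists s => //.
have := segment_between cxw tI; have := segment_between ayw t'I.
have := segment_between axy s'I; have := segment_start axy sI.
have := segment_start axy s'I.
rewrite /between /gp (metric_sym w x) (metric_sym w y) (metric_sym w (a s)).
have := metric_triangle x (c t) (a s); have := metric_triangle (a s) (c t) w.
have := metric_triangle y (b t') (a s').
have := metric_triangle (a s') (b t') w.
have := metric_triangle (a s) (a s') w.
rewrite ad// (metric_sym (b t') (a s')) (metric_sym (c t) (a s)).
by rewrite (metric_sym y (a s')); case: ss'; lra.
Qed.

(** The Gromov product at w is comparable to the distance from w to the side.
    A point of the side from x to z that realizes this distance coarsely is
    delta-close to one of the other two sides of the triangle x, y, z. *)
Lemma slim_four_point : four_point (X := X) (3 * delta + 2).
Proof.
move=> w x y z.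
have [a axz] := gX x z; have [b byz] := gX z y; have [c cxy] := gX x y.
have [s sI sw] := slim_dist_segment w axz.
have [[t tI st]|[t tI st]] := hX axz byz cxy sI; [right|left].
  have := gromov_product_le_dist w (segment_between byz tI).
  rewrite (gromov_productC w z).
  by have := metric_triangle w (a s) (b t); lra.
have := gromov_product_le_dist w (segment_between cxy tI).
by have := metric_triangle w (a s) (c t); lra.
Qed.

End SlimTriangles.

(** * Geodesic rays in a hyperbolic space *)

Section Rays.
Context {R : realType} {X : metricType R} (e : R).
Hypotheses (e0 : 0 <= e) (fpX : four_point (X := X) e).
Local Notation gp := gromov_product.
Implicit Types (g h : R -> X) (o p q w x y z : X).

Lemma ray_dist x g t : geodesic_ray g -> 0 <= t ->
  t - mdist x (g 0) <= mdist x (g t) <= t + mdist x (g 0).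
Proof.
move=> gr t0; have := gr 0 t (lexx _) t0.
rewrite sub0r normrN ger0_norm// => gt.
have := metric_triangle (g 0) x (g t); have := metric_triangle x (g 0) (g t).
by rewrite (metric_sym (g 0) x) => *; apply/andP; split; lra.
Qed.

Lemma gromov_product_ray x g s t : geodesic_ray g -> 0 <= s <= t ->
  s - mdist x (g 0) <= gp x (g s) (g t).
Proof.
move=> gr /andP[s0 st]; have t0 := le_trans s0 st.
have /andP[? _] := ray_dist x gr s0; have /andP[? _] := ray_dist x gr t0.
by rewrite /gp gr// ler0_norm; lra.
Qed.

(** Both p and q coarsely lie on the way from o to z, at the same distance t
    from o. *)
Lemma fellow_travel o p q z t c : mdist o p <= t + c -> mdist o q <= t + c ->
  t - c <= gp o p z -> t - c <= gp o q z -> mdist p q <= 4 * c + 2 * e.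
Proof.
move=> op oq pz qz; have := fpX o p z q; rewrite (gromov_productC o z q).
suff : t - c - e <= gp o p q -> mdist p q <= 4 * c + 2 * e.
  by move=> H [] ?; apply: H; lra.
by rewrite /gp; lra.
Qed.

(** A geodesic from o to a point of a ray follows the ray, with a bound that
    does not depend on how far that point is: this is what survives in
    the limit. *)
Lemma segment_fellow_ray o p g s t : geodesic_ray g -> 0 <= s <= t ->
  mdist o p = s -> between p o (g t) ->
  mdist p (g s) <= 4 * mdist o (g 0) + 2 * e.
Proof.
move=> gr /[dup] st /andP[s0 _] os bp; have c0 := mdist_ge0 o (g 0).
apply: (@fellow_travel o p (g s) (g t) s) => //.
- by lra.
- by case/andP: (ray_dist o gr s0).
- by move: bp; rewrite /between /gp; lra.
- exact: gromov_product_ray.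
Qed.

(** If the Gromov product of g n and h n exceeded t, up to a constant, for some
    n >= t, then g t and h t would both lie coarsely on the way to h n and be
    uniformly close. Non-asymptotic rays have a time t at which they are not. *)
Lemma divergent_rays x g h : geodesic_ray g -> geodesic_ray h ->
  ~ asymptotic g h ->
  exists M T : R, 0 <= T /\ forall t, T <= t -> gp x (g t) (h t) <= M.
Proof.
move=> gr hr gh; pose c : R := mdist x (g 0) + mdist x (h 0) + e.
have [t [t0 tc]] : exists t : R, 0 <= t /\ 4 * c + 2 * e < mdist (g t) (h t).
  apply: contrapT => ngh; apply: gh; exists (4 * c + 2 * e) => t t0.
  by rewrite leNgt; apply/negP => lt; apply: ngh; exists t.
exists (t - mdist x (g 0) - mdist x (h 0)), t; split => // n tn.
rewrite leNgt; apply/negP => lt; move: tc; apply/negP; rewrite -leNgt.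
have tI : 0 <= t <= n by rewrite t0.
have cg := mdist_ge0 x (g 0); have ch := mdist_ge0 x (h 0).
have gg := gromov_product_ray x gr tI; have hh := gromov_product_ray x hr tI.
have /andP[_ g1] := ray_dist x gr t0; have /andP[_ h1] := ray_dist x hr t0.
apply: (@fellow_travel x (g t) (h t) (h n) t); rewrite {}/c;
  [lra_hyps|lra_hyps| |lra_hyps].
by have := fpX x (g t) (g n) (h n); case; lra_hyps.
Qed.

Lemma asymptotic_sym g h : asymptotic g h -> asymptotic h g.
Proof. by case=> C gh; exists C => t /gh; rewrite metric_sym. Qed.

Lemma asymptotic_trans g h k :
  asymptotic g h -> asymptotic h k -> asymptotic g k.
Proof.
case=> C gh [C' hk]; exists (C + C') => t t0.
by have := metric_triangle (g t) (h t) (k t); have := gh t t0; have := hk t t0;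
  lra.
Qed.

Lemma asymptotic_class_eq g h :
  asymptotic g h -> asymptotic_class g = asymptotic_class h.
Proof.
move=> gh; apply/seteqP; split=> k [kr ak]; split=> //.
  by apply: asymptotic_trans ak; apply: asymptotic_sym.
exact: asymptotic_trans ak.
Qed.

End Rays.

(** * Lines between boundary points as ultralimits of segments *)

Section LimitLines.
Context {R : realType} {X : metricType R} (U : set_system R).
Context {UU : UltraFilter U}.
Hypothesis Uoo : forall T, U [set t | T <= t]%classic.
Hypothesis pX : proper_space X.
Local Notation gp := gromov_product.

(** Applied at each time of a family of paths, this yields a pointwise limit
    along the same ultrafilter for all times at once, without a diagonal
    extraction. *)
Lemma ultralimit (u : R -> X) x r : U [set t | mdist x (u t) <= r]%classic ->
  exists p, forall eps : R, 0 < eps -> U [set t | mdist p (u t) < eps]%classic.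
Proof.
move=> Ur.
have [p [_ pc]] := @pX x r (nbhs (u @ U)%classic) _ Ur.
exists p => eps eps0.
have [//|nU] := in_ultra_setVsetC [set t | mdist p (u t) < eps]%classic UU.
have pb : nbhs p [set y | mdist p y < eps]%classic.
  by apply/metricType_numDomainType.nbhs_mdistP; exists eps.
by have [y [/= ]] := pc (~` [set y | mdist p y < eps])%classic _ nU pb.
Qed.

(** The last clause records that the segments from g n to h n come close to
    each point of the limit line: whatever is near the line has small
    Gromov product with respect to g n and h n. *)
Lemma limit_line (e delta : R) (g h : R -> X) :
    0 <= e -> four_point (X := X) e -> geodesic_space X ->
    0 <= delta -> delta_hyperbolic X delta ->
    geodesic_ray g -> geodesic_ray h -> ~ asymptotic g h ->
  exists l, [/\ geodesic_line l, asymptotic g (fun t => l (- t)),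
    asymptotic h l &
    forall b t, U [set n | gp b (g n) (h n) <= mdist b (l t) + 1]%classic].
Proof.
move=> e0 fpX gX d0 hX gr hr gh; pose x := g 0.
have [M [T [T0 MT]]] := divergent_rays e0 fpX x gr hr gh.
have /choice[c cP] n : exists c, geodesic_segment (g n) (h n) c by apply: gX.
have /choice[s sP] n : exists s : R, 0 <= s <= mdist (g n) (h n) /\
    mdist x (c n s) <= gp x (g n) (h n) + 2 * (delta + 1).
  by have [s] := slim_dist_segment d0 gX hX x (cP n); exists s.
(* The segments are parametrized from their points o n, which remain within r
   of the base point x. *)
pose o n := c n (s n); pose r := M + 2 * (delta + 1).
pose dh := mdist x (h 0).
have oP n : T <= n -> mdist x (o n) <= r.
  by move=> /MT; have [_] := sP n; rewrite /r /o; lra_hyps.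
(* Both ends of the segments move away from o n, so that every parameter
   eventually lies in the domain. *)
have on_segment (t : R) :
    U [set n | [/\ `|t| <= n, T <= n &
      0 <= s n + t <= mdist (g n) (h n)]]%classic.
  apply: filterS (Uoo (`|t| + T + `|r| + dh)) => n /= tn.
  have t0 := normr_ge0 t; have r0 := ler_norm r.
  have tl := ler_norm t; have tl' := ler_norm (- t); rewrite normrN in tl'.
  have dh0 : 0 <= dh by apply: mdist_ge0.
  have rr0 := normr_ge0 r.
  have Tn : T <= n by lra_hyps.
  have n0 : 0 <= n by lra_hyps.
  split=> //; first by lra_hyps.
  have [sI _] := sP n; have xo := oP n Tn.
  have so := segment_start (cP n) sI; have bo := segment_between (cP n) sI.
  have /andP[g1 _] := ray_dist (o n) gr n0.
  have /andP[h1 _] := ray_dist (o n) hr n0.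
  have oh := metric_triangle (o n) x (h 0).
  move: bo so g1 h1 oh; rewrite /between -/(o n) -/x -/dh.
  rewrite (metric_sym (o n) (g n)) (metric_sym (o n) x) => *.
  by apply/andP; split; lra_hyps.
have lim t : exists p, forall eps : R, 0 < eps ->
    U [set n | mdist p (c n (s n + t)) < eps]%classic.
  apply: (@ultralimit _ x (r + `|t|)).
  apply: filterS (on_segment t) => n [_ Tn sI] /=.
  have [_ _ cd] := cP n; have [sI0 _] := sP n.
  have := metric_triangle x (o n) (c n (s n + t)); have := oP n Tn.
  rewrite {2}/o cd// opprD addNKr normrN; lra_hyps.
have {lim} /choice[l lP] := lim.
exists l; split.
- move=> t t'; apply/eqP; rewrite -subr_eq0 -normr_le0.
  apply/ler_addgt0Pl => /= eps eps0.
  have e2 : 0 < eps / 2 by lra_hyps.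
  have [n [[lt lt'] [[_ _ sI] [_ _ sI']]]] := filter_ex
    (filterI (filterI (lP t _ e2) (lP t' _ e2))
             (filterI (on_segment t) (on_segment t'))).
  have [_ _ cd] := cP n; move: lt lt' => /=.
  have := cd _ _ sI sI'; rewrite opprD addrACA subrr add0r => <-.
  move: (c n (s n + t)) (c n (s n + t')) => q q' lt lt'.
  have := metric_triangle (l t) q (l t'); have := metric_triangle q q' (l t').
  have := metric_triangle q (l t) q'; have := metric_triangle (l t) (l t') q'.
  rewrite (metric_sym q (l t)) (metric_sym q' (l t')) ler_norml => *.
  by apply/andP; split; lra_hyps.
- exists (4 * r + 2 * e + 1) => t t0.
  have [n [/= lt [tn Tn sI]]] := filter_ex
    (filterI (lP (- t) _ ltr01) (on_segment (- t))).
  rewrite normrN ger0_norm// in tn; have [sI0 _] := sP n.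
  have [_ _ cd] := cP n.
  have op : mdist (o n) (c n (s n - t)) = t.
    by rewrite cd// opprD addNKr opprK ger0_norm.
  have bp : between (c n (s n - t)) (o n) (g n).
    rewrite /between op (metric_sym _ (g n)) (metric_sym _ (g n)).
    by rewrite (segment_start (cP n) sI) (segment_start (cP n) sI0); lra.
  have tI : 0 <= t <= n by rewrite t0.
  have := segment_fellow_ray fpX gr tI op bp.
  have := metric_triangle (g t) (c n (s n - t)) (l (- t)).
  have := oP n Tn; rewrite (metric_sym (o n) (g 0)) -/x.
  rewrite (metric_sym (g t) (c n (s n - t))).
  by rewrite (metric_sym (c n (s n - t)) (l (- t))); lra_hyps.
- exists (4 * (r + dh) + 2 * e + 1) => t t0.
  have [n [/= lt [tn Tn sI]]] := filter_ex
    (filterI (lP t _ ltr01) (on_segment t)).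
  rewrite ger0_norm// in tn; have [sI0 _] := sP n.
  have [_ _ cd] := cP n.
  have op : mdist (o n) (c n (s n + t)) = t.
    by rewrite cd// opprD addNKr normrN ger0_norm.
  have bp : between (c n (s n + t)) (o n) (h n).
    have := segment_between (cP n) sI; have := segment_between (cP n) sI0.
    rewrite /between op (segment_start (cP n) sI) (segment_start (cP n) sI0).
    by rewrite -/(o n); lra.
  have tI : 0 <= t <= n by rewrite t0.
  have := segment_fellow_ray fpX hr tI op bp.
  have := metric_triangle (h t) (c n (s n + t)) (l t).
  have := metric_triangle (o n) x (h 0).
  have := oP n Tn; rewrite (metric_sym (o n) x) -/dh.
  rewrite (metric_sym (h t) (c n (s n + t))).
  by rewrite (metric_sym (c n (s n + t)) (l t)); lra_hyps.
- move=> b t; apply: filterS (filterI (lP t _ ltr01) (on_segment t)) => n.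
  move=> [/= lt [_ _ sI]].
  have := gromov_product_le_dist b (segment_between (cP n) sI).
  by have := metric_triangle b (l t) (c n (s n + t)); lra_hyps.
Qed.

End LimitLines.

(** * A tripod at every point *)

Section Tripods.
Context {R : realType} {X : metricType R}.
Local Notation gp := gromov_product.

Lemma boundary_rays (xi : boundary3 X) : exists g : 'I_3 -> R -> X,
  [/\ forall i, geodesic_ray (g i),
      forall i, sval (sval xi i) = asymptotic_class (g i) &
      forall i j, i != j -> ~ asymptotic (g i) (g j)].
Proof.
have /choice[g gP] i : exists g, geodesic_ray g /\
    sval (sval xi i) = asymptotic_class g.
  by have [g] := svalP (sval xi i); exists g.
exists g; split=> [i|i|i j ij gij]; [exact: (gP i).1|exact: (gP i).2|].
move/eqP: ij; apply; apply: (svalP xi); apply: eq_sig_hprop => [A p q|].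
  exact: Prop_irrelevance.
by rewrite (gP i).2 (gP j).2 (asymptotic_class_eq gij).
Qed.

Variables (delta D L : R).
Hypotheses (d0 : 0 <= delta) (pX : proper_space X) (gX : geodesic_space X)
  (hX : delta_hyperbolic X delta).
Variable b : boundary3 X -> X.
Hypotheses (bX : is_barycenter_map D b) (bL : coarsely_surjective_with L b).

(** The rays need not start at x: the points sought are taken on the geodesics
    from x to far points of the rays, since moving a point towards x along a
    geodesic can only decrease its Gromov products at x. *)
Lemma tripod_at x N : 0 <= N -> exists2 f : 'I_3 -> X,
  forall i, mdist x (f i) = N &
  forall i j, i != j -> gp x (f i) (f j) <= D + L + 1.
Proof.
move=> N0; have [xi xb] := bL x; have [g [gr gE gg]] := boundary_rays xi.
have e0 : 0 <= 3 * delta + 2 by lra_hyps.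
have fpX := slim_four_point d0 gX hX.
have [U [UU sU]] := ultraFilterLemma (@proper_pinfty_nbhs R).
have Uoo T : U [set t | T <= t]%classic.
  by apply: sU; apply: nbhs_pinfty_ge; rewrite num_real.
have Uij i j : U [set n | i != j -> gp x (g i n) (g j n) <= D + L + 1]%classic.
  have [->|ij] := eqVneq i j; first exact: filterE.
  have [l [ll li lj lU]] :=
    limit_line Uoo pX e0 fpX gX d0 hX (gr i) (gr j) (gg _ _ ij).
  have [|t lt] := @bX xi i j l ij.
    split=> //; rewrite /converges_to gE; split=> // s t s0 t0.
    by rewrite ll opprK addrC distrC.
  apply: filterS (lU (b xi) t) => n /= bn _.
  by have := gromov_product_base (b xi) x (g i n) (g j n); lra_hyps.
have Uall : U [set n | forall i j,
    i != j -> gp x (g i n) (g j n) <= D + L + 1]%classic.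
  exact: (filter_forall _ (fun i => filter_forall _ (Uij i))).
have Ufar : U [set n | forall i, N <= mdist x (g i n)]%classic.
  apply: filter_forall => i.
  apply: filterS (filterI (Uoo (N + mdist x (g i 0))) (Uoo 0)) => n /= [Nn n0].
  by have /andP[] := ray_dist x (gr i) n0; lra_hyps.
have [n [gn far]] := filter_ex (filterI Uall Ufar).
have /choice[f fP] i : exists p, mdist x p = N /\ between p x (g i n).
  have [c cP] := gX x (g i n).
  have NI : 0 <= N <= mdist x (g i n) by rewrite N0 far.
  exists (c N); split; [exact: segment_start cP NI|].
  exact: segment_between cP NI.
exists f => [i|i j ij]; first exact: (fP i).1.
apply: le_trans (gn i j ij).
apply: le_trans (gromov_product_between (g j n) (fP i).2).
by rewrite gromov_productC [leRHS]gromov_productC;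
  apply: gromov_product_between; exact: (fP j).2.
Qed.

End Tripods.

(** * Embedding the trivalent tree *)

Section TreeEmbedding.
Context {R : realType} {X : metricType R}.
Local Notation gp := gromov_product.

(** The distance in the tree between the vertices u and v. *)
Definition word_dist (u v : seq 'I_3) : nat :=
  (size u + size v - (lcp u v).*2)%N.

(** The point y is where a path reaching x comes from, and c is the label of the
    one direction at x that is allowed to lead back towards y; the labels are
    those of the edges of the tree. *)
Definition forks (C N : R) (x y : X) (c : 'I_3) (f : 'I_3 -> X) : Prop :=
  [/\ forall a, mdist x (f a) = N,
      forall a a', a != a' -> gp x (f a) (f a') <= C &
      forall a, a != c -> gp x y (f a) <= C].

(** Two legs j and a of a tripod cannot both point towards y, by the four-point
    inequality between f j, y and f a. Relabelling by a transposition gives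
    the exceptional leg the prescribed label c. *)
Lemma tripod_forks (e C N : R) (x y : X) (c : 'I_3) (f : 'I_3 -> X) :
  0 <= e -> four_point (X := X) e ->
  (forall a, mdist x (f a) = N) ->
  (forall a a', a != a' -> gp x (f a) (f a') <= C) ->
  exists f', forks (C + e) N x y c f'.
Proof.
move=> e0 fpX fN fC.
have [j jP] : exists j, forall a, a != j -> gp x y (f a) <= C + e.
  have [[j jC]|nj] := pselect (exists j, C + e < gp x y (f j)).
    exists j => a aj; have := fC _ _ aj; have := fpX x (f a) y (f j).
    by rewrite (gromov_productC x (f a) y) => -[]; lra_hyps.
  by exists c => a _; rewrite leNgt; apply/negP => la; apply: nj; exists a.
exists (f \o tperm c j); split=> [a|a a' aa'|a ac] /=; first exact: fN.
  apply: le_trans (fC _ _ _) _; last by rewrite lerDl.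
  by rewrite (inj_eq perm_inj).
by apply: jP; rewrite -[X in _ != X](tpermL c j) (inj_eq perm_inj).
Qed.

Variables (e C N : R) (F : X -> X -> 'I_3 -> 'I_3 -> X).
Hypotheses (e0 : 0 <= e) (fpX : four_point (X := X) e) (C0 : 0 <= C)
  (NC : 2 * C + 4 * e + 1 <= N)
  (FP : forall x y c, forks C N x y c (F x y c)).

(** A state consists of the current point, the previous point and the last
    letter read. *)
Definition step (st : X * X * 'I_3) (a : 'I_3) : X * X * 'I_3 :=
  let: (x, y, c) := st in (F x y c a, x, a).

Definition walk st w : X := (foldl step st w).1.1.

(** Local-to-global principle. By induction, from the next vertex f the end
    point z is seen away from x, so that from x it is seen in the direction of
    f up to N - C - e; and f is not in the direction of y. *)
Lemma walk_no_return x y c w : path (fun a b => a != b) c w ->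
  gp x y (walk (x, y, c) w) <= C + e.
Proof.
elim: w x y c => [|a w IH] x y c /=.
  by rewrite /walk /= gromov_productC gromov_productx => _; lra_hyps.
case/andP=> ca /(IH (F x y c a) x a); rewrite -/(walk _ _).
set z := walk _ _; rewrite -[walk _ _]/z => zP.
have [fN _ fy] := FP x y c; have := fy a; rewrite eq_sym => /(_ ca) ya.
have := gromov_product_swap x (F x y c a) z; rewrite fN => sw.
by case: (fpX x y z (F x y c a)) => [|];
  rewrite ?(gromov_productC x z (F x y c a)); lra_hyps.
Qed.

Lemma walk_away x y c a w : path (fun a b => a != b) a w ->
  N - C - e <= gp x (F x y c a) (walk (x, y, c) (a :: w)).
Proof.
move=> /(walk_no_return (F x y c a) x) aw; have [fN _ _] := FP x y c.
by have := gromov_product_swap x (F x y c a) (walk (x, y, c) (a :: w));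
  rewrite fN -[walk (x, y, c) _]/(walk (F x y c a, x, a) w); lra_hyps.
Qed.

Lemma walk_length x y c w : sorted (fun a b => a != b) w ->
  (size w)%:R <= mdist x (walk (x, y, c) w).
Proof.
elim: w x y c => [|a w IH] x y c; first by rewrite mdist_ge0.
move=> /= aw; have := walk_away x y c aw; have [fN _ _] := FP x y c.
have /(IH (F x y c a) x a) : sorted (fun a b => a != b) w.
  exact: path_sorted aw.
rewrite -[walk (x, y, c) _]/(walk (F x y c a, x, a) w) -natr1 /gp fN.
by lra_hyps.
Qed.

Lemma walk_dist_le x y c w : mdist x (walk (x, y, c) w) <= (size w)%:R * N.
Proof.
elim: w x y c => [|a w IH] x y c; first by rewrite /walk /= mdistxx mul0r.
have := IH (F x y c a) x a; have [fN _ _] := FP x y c.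
rewrite -[walk (x, y, c) _]/(walk (F x y c a, x, a) w) /= -natr1 mulrDl mul1r.
by have := metric_triangle x (F x y c a) (walk (F x y c a, x, a) w);
  rewrite fN; lra_hyps.
Qed.

(** The common prefix of u and v only moves the state. After it, the two walks
    leave x through two different legs of a tripod, so that their end points
    have Gromov product at most C + 2 e at x. *)
Lemma walk_qi st u v :
  sorted (fun a b => a != b) u -> sorted (fun a b => a != b) v ->
  (word_dist u v)%:R - N <= mdist (walk st u) (walk st v) <=
  (word_dist u v)%:R * N.
Proof.
elim: u v st => [|a u IH] [|b v] [[x y] c] su sv; rewrite /word_dist.
- rewrite mdistxx [(_ - _)%N]/= mul0r lexx andbT.
  by rewrite mulr0n sub0r oppr_le0; lra_hyps.
- have := walk_length x y c sv; have := walk_dist_le x y c (b :: v).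
  rewrite [lcp _ _]/= add0n subn0 => *; apply/andP; split=> //.
  by rewrite -[walk _ [::]]/x; lra_hyps.
- have := walk_length x y c su; have := walk_dist_le x y c (a :: u).
  rewrite [lcp _ _]/= addn0 subn0 metric_sym => *; apply/andP; split=> //.
  by rewrite -[walk _ [::]]/x; lra_hyps.
rewrite [lcp _ _]/=; have [ab|ab] := eqVneq a b.
  subst b; rewrite -[walk _ (a :: u)]/(walk (step (x, y, c) a) u).
  rewrite -[walk _ (a :: v)]/(walk (step (x, y, c) a) v).
  have -> : (size (a :: u) + size (a :: v) - (lcp u v).+1.*2 =
    size u + size v - (lcp u v).*2)%N by rewrite /= doubleS; lia.
  by apply: IH; [exact: path_sorted su|exact: path_sorted sv].
rewrite double0 subn0 natrD.
have := walk_length x y c su; have := walk_dist_le x y c (a :: u).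
have := walk_length x y c sv; have := walk_dist_le x y c (b :: v).
have := walk_away x y c su; have := walk_away x y c sv.
set p := walk _ (a :: u); set q := walk _ (b :: v) => qb pa q1 q2 p1 p2.
have [fN fab _] := FP x y c; have ab' := fab _ _ ab.
have pb : gp x p (F x y c b) <= C + e.
  have := fpX x (F x y c a) p (F x y c b).
  by case; lra_hyps.
have pq : gp x p q <= C + 2 * e.
  have := fpX x p q (F x y c b); rewrite (gromov_productC x q).
  by case; lra_hyps.
have tr := metric_triangle p x q; rewrite (metric_sym p x) in tr.
move: pq; rewrite /gp => pq.
by apply/andP; split; lra_hyps.
Qed.

Lemma lcp_le_size (u v : seq 'I_3) : (lcp u v <= size u)%N.
Proof.
by elim: u v => [|a u IH] [|b v] //=; case: eqP => // _; rewrite ltnS.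
Qed.

(** Each point is compared to the vertex at the far end of its edge, at
    distance less than 1. *)
Lemma word_dist_T3 (p q : T3 R) :
  (word_dist (sval p).1 (sval q).1)%:R - 2 <= mdist p q <=
  (word_dist (sval p).1 (sval q).1)%:R + 2.
Proof.
rewrite /word_dist /mdist /= /T3_dist.
have sp := T3_sP p; have sq := T3_sP q.
have [bl bp bq] := T3_branch_le p q.
have lp := lcp_le_size (sval p).1 (sval q).1.
have := lcp_le_size (sval q).1 (sval p).1; rewrite lcpC => lq.
have bl' : (lcp (sval p).1 (sval q).1)%:R - 1 <= T3_branch p q.
  have lpR : (lcp (sval p).1 (sval q).1)%:R <= (size (sval p).1)%:R :> R.
    by rewrite ler_nat.
  have lqR : (lcp (sval p).1 (sval q).1)%:R <= (size (sval q).1)%:R :> R.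
    by rewrite ler_nat.
  rewrite /T3_branch !le_min /T3_height; case/andP: sp; case/andP: sq => *.
  by apply/and3P; split; lra_hyps.
have dl : ((lcp (sval p).1 (sval q).1).*2 <=
    size (sval p).1 + size (sval q).1)%N.
  by rewrite -addnn leq_add.
rewrite natrB// natrD -addnn natrD.
move: bl' bl; rewrite /T3_height; case/andP: sp; case/andP: sq => *.
by apply/andP; split; lra_hyps.
Qed.

Lemma tree_embedding (x0 : X) :
  exists phi : T3 R -> X, qi_embedding_with (2 * N + 2) phi.
Proof.
have N0 : 0 <= N by move: e0 C0 NC; lra.
(* At the root there is no previous point and all three letters are used; this
   is harmless, as walks from a common state are compared by the mutual
   Gromov products of the legs. *)
exists (fun p => walk (x0, x0, ord0) (sval p).1).
have k1 : 1 <= 2 * N + 2 by move: N0; lra.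
split=> // p q; have red (r : T3 R) : sorted (fun a b => a != b) (sval r).1.
  by case/and3P: (svalP r).
have := word_dist_T3 p q; have := walk_qi (x0, x0, ord0) (red p) (red q).
move: (word_dist _ _)%:R (mdist (walk _ _) _) => n d /andP[d1 d2] /=.
move=> /andP[T1 T2]; have T0 : 0 <= mdist p q by apply: mdist_ge0.
move: (mdist p q) => T in T1 T2 T0 *; apply/andP; split.
  have kT : (2 * N + 2)^-1 * T <= T.
    by rewrite ler_piMl// invf_le1//; move: N0; lra.
  by move: kT d1 T1 T2 N0; lra.
have nN : n * N <= (T + 2) * N by apply: ler_wpM2r => //; move: T1; lra.
have TN : 0 <= T * N by apply: mulr_ge0.
by move: TN nN; rewrite !mulrDl; move: d2 T0 N0; lra.
Qed.

End TreeEmbedding.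

(** Slim triangles give the four-point inequality with e = 3 delta + 2, the
    forks have Gromov products at most C = D + L + 1 + e, and legs of
    length N = 2 C + 4 e + 1 suffice. *)
Lemma barycenter_tree_embedding (R : realType) (X : metricType R)
    (delta D L : R) (b : boundary3 X -> X) :
  inhabited X -> proper_space X -> geodesic_space X ->
  0 <= delta -> 0 <= D -> 0 <= L -> delta_hyperbolic X delta ->
  is_barycenter_map D b -> coarsely_surjective_with L b ->
  exists phi : T3 R -> X,
    qi_embedding_with (4 * (D + L) + 36 * delta + 32) phi.
Proof.
move=> [x0] pX gX d0 D0 L0 hX bX bL.
pose e := 3 * delta + 2; pose C := D + L + 1 + e; pose N := 2 * C + 4 * e + 1.
have e0 : 0 <= e by rewrite /e; lra_hyps.
have C0 : 0 <= C by rewrite /C; lra_hyps.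
have N0 : 0 <= N by rewrite /N; lra_hyps.
have fpX := slim_four_point d0 gX hX.
have FP (x y : X) c : exists f, forks C N x y c f.
  have [f fN fC] := tripod_at d0 pX gX hX bX bL x N0.
  exact: tripod_forks e0 fpX fN fC.
have /choice[F {}FP] : forall s : X * X * 'I_3,
    exists f, forks C N s.1.1 s.1.2 s.2 f by move=> s; apply: FP.
suff <- : 2 * N + 2 = 4 * (D + L) + 36 * delta + 32.
  exact: (tree_embedding (F := fun x y c => F (x, y, c)) e0 fpX C0
    (lexx N) (fun x y c => FP (x, y, c)) x0).
by rewrite /N /C /e; lra.
Qed.

Theorem theorem1p8 (R : realType) (D0 : R -> R)
    (hD0 : forall delta : R, 0 <= delta -> 0 <= D0 delta) :
  (forall (X : metricType R) (delta : R) (b : boundary3 X -> X),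
      inhabited X -> proper_space X -> geodesic_space X ->
      0 <= delta -> delta_hyperbolic X delta ->
      is_barycenter_map (D0 delta) b -> coarsely_surjective b ->
      exists phi : T3 R -> X, qi_embedding phi)
  /\
  (forall delta L : R, 0 <= delta -> 0 <= L ->
    exists2 k : R, 1 <= k &
      forall (X : metricType R) (b : boundary3 X -> X),
        inhabited X -> proper_space X -> geodesic_space X ->
        delta_hyperbolic X delta ->
        is_barycenter_map (D0 delta) b -> coarsely_surjective_with L b ->
        exists phi : T3 R -> X, qi_embedding_with k phi).
Proof.
split=> [X delta b iX pX gX d0 hX bX [L L0 bL]|delta L d0 L0].
  have [phi phiP] :=
    barycenter_tree_embedding iX pX gX d0 (hD0 _ d0) L0 hX bX bL.
  by exists phi; eexists; exact: phiP.
exists (4 * (D0 delta + L) + 36 * delta + 32).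
  by have := hD0 _ d0; move: d0 L0; lra.
by move=> X b iX pX gX; apply: barycenter_tree_embedding => //; exact: hD0.
Qed.
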